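(* Let $k=\mathbb{Z}/(2)$, let $n\ge 1$, let $C=k[u_1,\ldots,u_n,v_1,\ldots,v_n]$ be a polynomial ring in $2n$ variables, and let $s:C\to C$ be the $k$-derivation $s=\sum_{i=1}^n u_i\frac{\partial}{\partial v_i}$. Let $B=\ker(s)\subset C$ and let $A=k[u_1,\ldots,u_n,v_1^2,\ldots,v_n^2]\subset B$. For $T\subset\{1,\ldots,n\}$ put $v_T=\prod_{i\in T}v_i$ (so $v_\emptyset=1$). (I) (Generators) We have $s^2=0$ and $B=\ker(s)=\operatorname{im}(s)+A$. Consequently, $B$ is generated as an $A$-module by $1$ together with the $2^n-n-1$ other elements $s(v_T)$, where $T$ ranges over all subsets $T\subset\{1,\ldots,n\}$ of cardinality $\ge 2$. (II) (Relations) Let $A[c_T]$ be the polynomial ring over $A$ in the $2^n-n-1$ algebraically independent variables $c_T$, indexed by all subsets $T\subset\{1,\ldots,n\}$ of cardinality $\ge 2$; in addition put $c_\emptyset=0$ and $c_{\{i\}}=u_i$ for $1\le i\le n$. Let $N$ be the ideal in $A[c_T]$ generated by (1) the $2^n-n(n-1)/2-n-1$ elements $$\sum_{i\in T}u_i\,c_{T-\{i\}}$$ where $T\subset\{1,\ldots,n\}$ is a subset of cardinality $\ge 3$; (2) the $n(n-1)/2$ elements $$(c_{\{i,j\}})^2+u_i^2v_j^2+u_j^2v_i^2$$ where $\{i,j\}\subset\{1,\ldots,n\}$ is a subset of cardinality $2$; (3) the $(2^n-n-1)^2-n(n-1)/2$ elements (not necessarily distinct) $$c_T\,c_U+\sum_{p\in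 T}u_p\Big(\prod_{q\in (T\cap U)-\{p\}}v_q^2\Big)\,c_{(T-\{p\})\Delta U}$$ where $T,U\subset\{1,\ldots,n\}$ are subsets of cardinality $\ge 2$, with $T\ne U$ in case both $T$ and $U$ have cardinality $2$. Then there is an isomorphism of $A$-algebras $A[c_T]/N\to B$ mapping $c_T\mapsto s(v_T)$.
   Context: $\Delta$ denotes symmetric difference of sets: $X\Delta Y=(X-Y)\cup(Y-X)$. An empty product equals $1$. The derivation $s$ is determined by $s(u_i)=0$ and $s(v_i)=u_i$ for $1\le i\le n$. *)

(* Defs.v *)
From HB Require Import structures.
From mathcomp Require Import all_boot all_order all_algebra.
From mathcomp Require Import boolp.
From mathcomp Require Import mpoly.

Set Implicit Arguments.
Unset Strict Implicit.
Unset Printing Implicit Defensive.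

Import GRing.Theory.

Local Open Scope ring_scope.
Local Open Scope quotient_scope.

Definition k : fieldType := 'F_2.

(* The variables of C are indexed by 'I_(n + n): first the u_i, then the v_i. *)
Notation Cring n := {mpoly k[n + n]}.

Definition u n (i : 'I_n) : Cring n := 'X_(lshift n i).
Definition v n (i : 'I_n) : Cring n := 'X_(rshift n i).

Definition vT n (T : {set 'I_n}) : Cring n := \prod_(i in T) v i.

Definition s n (p : Cring n) : Cring n :=
  \sum_(i < n) u i * p^`M(rshift n i).

Definition kers n : {pred Cring n} := [pred p : Cring n | s p == 0].
Arguments kers n : clear implicits.

Lemma kers_subring n : GRing.subring_closed (kers n).
Proof.
have sM (p q : Cring n) : s (p * q) = s p * q + p * s q.
  rewrite /s mulr_suml mulr_sumr -big_split /=; apply: eq_bigr => i _.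
  by rewrite mderivM mulrDr; congr (_ + _); [exact: mulrA | exact: mulrCA].
split=> [|p q|p q]; rewrite !inE /=.
- by rewrite /s big1 // => i _; rewrite -mpolyC1 mderivC mulr0.
- move=> /eqP sp /eqP sq; apply/eqP.
  transitivity (s p - s q); last by rewrite sp sq subr0.
  rewrite /s -sumrB; apply: eq_bigr => i _.
  by rewrite mderivB mulrBr.
- by move=> /eqP sp /eqP sq; rewrite sM sp sq mul0r mulr0 addr0.
Qed.

HB.instance Definition _ n :=
  GRing.isSubringClosed.Build (Cring n) (kers n) (@kers_subring n).

Record Bring n := MkB { Bval : Cring n; _ : Bval \in kers n }.

HB.instance Definition _ n := [isSub for @Bval n].
HB.instance Definition _ n := [Choice of Bring n by <:].
HB.instance Definition _ n := [SubChoice_isSubComNzRing of Bring n by <:].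

(* The polynomials in the 2n elements u_i, v_i ^+ 2; membership is made
   boolean classically. *)
Definition Agen n : (n + n).-tuple (Cring n) :=
  [tuple match split j with inl i => u i | inr i => v i ^+ 2 end | j < n + n].

Definition inA n : {pred Cring n} :=
  [pred p : Cring n | asbool (exists q : Cring n, p = q \mPo Agen n)].
Arguments inA n : clear implicits.

Lemma inA_subring n : GRing.subring_closed (inA n).
Proof.
split=> [|_ _ /asboolP[p ->] /asboolP[q ->]|_ _ /asboolP[p ->] /asboolP[q ->]].
- by apply/asboolP; exists 1; rewrite rmorph1.
- by apply/asboolP; exists (p - q); rewrite rmorphB.
- by apply/asboolP; exists (p * q); rewrite rmorphM.
Qed.

HB.instance Definition _ n :=
  GRing.isSubringClosed.Build (Cring n) (inA n) (@inA_subring n).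

Record Aring n := MkA { Aval : Cring n; _ : Aval \in inA n }.

HB.instance Definition _ n := [isSub for @Aval n].
HB.instance Definition _ n := [Choice of Aring n by <:].
HB.instance Definition _ n := [SubChoice_isSubComNzRing of Aring n by <:].

Fact inA_u n (i : 'I_n) : u i \in inA n.
Proof.
apply/asboolP; exists 'X_(lshift n i).
by rewrite comp_mpolyXU -tnth_nth tnth_mktuple (unsplitK (inl i)).
Qed.

Fact inA_v2 n (i : 'I_n) : v i ^+ 2 \in inA n.
Proof.
apply/asboolP; exists 'X_(rshift n i).
by rewrite comp_mpolyXU -tnth_nth tnth_mktuple (unsplitK (inr i)).
Qed.

Definition uA n (i : 'I_n) : Aring n := MkA (inA_u i).
Definition v2A n (i : 'I_n) : Aring n := MkA (inA_v2 i).

Lemma inA_kers n (a : Aring n) : Aval a \in kers n.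
Proof.
case: a => p /= /asboolP[q ->].
have cst (c : k) : c%:MP \in kers n.
  by rewrite inE /= /s big1 // => i _; rewrite mderivC mulr0.
rewrite comp_mpolyEX; apply: rpred_sum => m _; rewrite -mul_mpolyC.
apply: rpredM => //; rewrite comp_mpolyX; apply: rpred_prod => j _.
apply: rpredX; rewrite tnth_mktuple; case: (split j) => i; rewrite inE /= /s.
  rewrite big1 // => l _; rewrite /u mderivX mnm1E.
  by rewrite eq_lrshift scale0r mulr0.
rewrite big1 // => l _; rewrite expr2 mderivM [v i * _]mulrC -mulr2n.
have two0 : 2%:R = 0 :> k by apply: val_inj.
by rewrite -mulr_natl -mpolyC_nat two0 mpolyC0 mul0r mulr0.
Qed.

(* B as an A-algebra, through the inclusion of A into B. *)
Definition AtoB n (a : Aring n) : Bring n := MkB (inA_kers a).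

Section BAlgebra.
Variable n : nat.

Definition Bscale (a : Aring n) (b : Bring n) : Bring n := AtoB a * b.

Fact BscaleA a b x : Bscale a (Bscale b x) = Bscale (a * b) x.
Proof. by apply: val_inj => /=; rewrite mulrA. Qed.
Fact Bscale1 : left_id 1 Bscale.
Proof. by move=> x; apply: val_inj => /=; rewrite mul1r. Qed.
Fact BscaleDr : right_distributive Bscale +%R.
Proof. by move=> a x y; rewrite /Bscale mulrDr. Qed.
Fact BscaleDl x : {morph Bscale^~ x : a b / a + b}.
Proof. by move=> a b; apply: val_inj => /=; rewrite mulrDl. Qed.

HB.instance Definition _ := GRing.Zmodule_isLmodule.Build (Aring n) (Bring n)
  BscaleA Bscale1 BscaleDr BscaleDl.

Fact BscaleAl (a : Aring n) (x y : Bring n) : a *: (x * y) = a *: x * y.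
Proof. exact: mulrA. Qed.

HB.instance Definition _ :=
  GRing.Lmodule_isLalgebra.Build (Aring n) (Bring n) BscaleAl.

End BAlgebra.

Definition large n (T : {set 'I_n}) : bool := (2 <= #|T|)%N.

Definition largeset n := {T : {set 'I_n} | large T}.
HB.instance Definition _ n := SubFinite.on (largeset n).

Notation Acring n := {mpoly (Aring n)[#|{: largeset n}|]}.

(* For #|T| < 2 the sum is 0 if T is empty, and u_i if T = [set i]. *)
Definition c n (T : {set 'I_n}) : Acring n :=
  if insub T : option (largeset n) is Some t then 'X_(enum_rank t)
  else (\sum_(i in T) uA i)%:MP.

Definition symdiff n (X Y : {set 'I_n}) : {set 'I_n} :=
  (X :\: Y) :|: (Y :\: X).

Definition relation1 n (T : {set 'I_n}) : Acring n :=
  \sum_(i in T) uA i *: c (T :\ i).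

Definition relation2 n (i j : 'I_n) : Acring n :=
  c [set i; j] ^+ 2 + (uA i ^+ 2 * v2A j + uA j ^+ 2 * v2A i)%:MP.

Definition relation3 n (T U : {set 'I_n}) : Acring n :=
  c T * c U
  + \sum_(p in T) (uA p * \prod_(q in (T :&: U) :\ p) v2A q)
                    *: c (symdiff (T :\ p) U).

Definition relations1 n : seq (Acring n) :=
  [seq relation1 T | T in [set T : {set 'I_n} | 3 <= #|T|]%N].

(* Unordered pairs {i, j} are enumerated by i < j. *)
Definition relations2 n : seq (Acring n) :=
  [seq relation2 ij.1 ij.2 | ij in [set ij : 'I_n * 'I_n | ij.1 < ij.2]%N].

Definition relations3 n : seq (Acring n) :=
  [seq relation3 TU.1 TU.2 | TU in
    [set TU : {set 'I_n} * {set 'I_n} |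
      [&& large TU.1, large TU.2 &
          (#|TU.1| == 2) && (#|TU.2| == 2) ==> (TU.1 != TU.2)]]%N].

Definition relations n : seq (Acring n) :=
  relations1 n ++ relations2 n ++ relations3 n.

Definition ideal_gen (R : comNzRingType) (g : seq R) (x : R) : Prop :=
  exists h : 'I_(size g) -> R, x = \sum_(i < size g) h i * g`_i.

Definition N n : {pred Acring n} :=
  [pred x : Acring n | asbool (ideal_gen (relations n) x)].
Arguments N n : clear implicits.

(* Every relation is sent to 0 by u, v, c_T |-> 0, so N is proper. *)
Section Proper.
Variable n : nat.

Let eps (x : Acring n) : k := (Aval x.@[fun=> 0]).@[fun=> 0].

Let epsM : {morph eps : x y / x * y}.
Proof. by move=> x y; rewrite /eps rmorphM /= rmorphM. Qed.
Let epsD : {morph eps : x y / x + y}.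
Proof. by move=> x y; rewrite /eps rmorphD /= rmorphD. Qed.
Let eps0 : eps 0 = 0.
Proof. by rewrite /eps rmorph0 /= rmorph0. Qed.
Let eps_sum (I : Type) (r : seq I) (P : pred I) F :
  (forall i, P i -> eps (F i) = 0) -> eps (\sum_(i <- r | P i) F i) = 0.
Proof.
move=> F0; elim/big_rec: _ => [|i x Pi xE]; first exact: eps0.
by rewrite epsD xE F0 // addr0.
Qed.
Let epsu i : eps (uA i)%:MP = 0.
Proof. by rewrite /eps mevalC /= /u mevalXU. Qed.

Let epsc T : eps (c T) = 0.
Proof.
rewrite /c; case: insubP => [t _ _|_]; last first.
  by rewrite rmorph_sum; apply: eps_sum => i _; exact: epsu.
by rewrite /eps mevalXU rmorph0.
Qed.

Let eps_rel x : x \in relations n -> eps x = 0.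
Proof.
rewrite !mem_cat => /or3P[] /imageP[].
- move=> T _ ->; apply: eps_sum => i _.
  by rewrite -mul_mpolyC epsM epsc mulr0.
- move=> [i j] _ -> /=; rewrite epsD expr2 epsM epsc mul0r add0r.
  by rewrite rmorphD epsD !rmorphM /= !epsM !epsu
             !mul0r addr0.
- move=> [T U] _ -> /=; rewrite epsD epsM epsc mul0r add0r.
  by apply: eps_sum => i _; rewrite -mul_mpolyC epsM epsc mulr0.
Qed.

Lemma N_ideal : idealr_closed (N n).
Proof.
split.
- apply/asboolP; exists (fun=> 0).
  by rewrite big1 // => i _; rewrite mul0r.
- apply/negP => /asboolP[h /(congr1 eps)]; rewrite eps_sum => [|i _].
    by rewrite /eps rmorph1 /= rmorph1 => /eqP; rewrite oner_eq0.
  by rewrite epsM (eps_rel (mem_nth 0 (ltn_ord i))) mulr0.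
- move=> a _ _ /asboolP[h ->] /asboolP[h2 ->]; apply/asboolP.
  exists (fun i => a * h i + h2 i).
  rewrite mulr_sumr -big_split /=; apply: eq_bigr => i _.
  by rewrite mulrDl mulrA.
Qed.

End Proper.

HB.instance Definition _ n := isIdealr.Build (Acring n) (N n) (@N_ideal n).

Definition Qring n := {ideal_quot (N n)}.

HB.instance Definition _ n := GRing.ComNzRing.on (Qring n).
HB.instance Definition _ n := EqQuotient.on (Qring n).
HB.instance Definition _ n := ZmodQuotient.on (Qring n).
HB.instance Definition _ n := NzRingQuotient.on (Qring n).

(* A[c_T]/N as an A-algebra, through A -> A[c_T] -> A[c_T]/N. *)
Section QAlgebra.
Variable n : nat.

Definition Qscale (a : Aring n) (x : Qring n) : Qring n :=
  \pi_(Qring n) a%:MP * x.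

Fact QscaleA a b x : Qscale a (Qscale b x) = Qscale (a * b) x.
Proof. by rewrite /Qscale mulrA -rmorphM -mpolyCM. Qed.
Fact Qscale1 : left_id 1 Qscale.
Proof. by move=> x; rewrite /Qscale mpolyC1 rmorph1 mul1r. Qed.
Fact QscaleDr : right_distributive Qscale +%R.
Proof. by move=> a x y; rewrite /Qscale mulrDr. Qed.
Fact QscaleDl x : {morph Qscale^~ x : a b / a + b}.
Proof. by move=> a b; rewrite /Qscale mpolyCD rmorphD mulrDl. Qed.

HB.instance Definition _ := GRing.Zmodule_isLmodule.Build (Aring n) (Qring n)
  QscaleA Qscale1 QscaleDr QscaleDl.

Fact QscaleAl (a : Aring n) (x y : Qring n) : a *: (x * y) = a *: x * y.
Proof. exact: mulrA. Qed.

HB.instance Definition _ :=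
  GRing.Lmodule_isLalgebra.Build (Aring n) (Qring n) QscaleAl.

End QAlgebra.

Definition generators n : seq (Cring n) :=
  1 :: [seq s (vT T) | T in [set T : {set 'I_n} | large T]].

(* Main.v *)
Require Import Defs.
From HB Require Import structures.
From mathcomp Require Import all_boot all_order all_algebra.
From mathcomp Require Import boolp.
From mathcomp Require Import ssrcomplements mpoly.
From mathcomp Require Import zify.

Set Implicit Arguments.
Unset Strict Implicit.
Unset Printing Implicit Defensive.

Import GRing.Theory.
Local Open Scope ring_scope.
Local Open Scope quotient_scope.

(** The ring [C] is free over [A] on the products [vT T], and with respect to
    this basis [s] is the Koszul differential of the sequence [u_1, .., u_n];
    no signs occur in characteristic 2. Everything follows from the exactness
    of this complex in positive degrees, where the degree of [a * vT T] is
    [#|T|].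

    Exactness is proved with an explicit contracting homotopy [hom], given on
    monomials. In one pair of variables, [u^a v^b |-> u^(a-1) v^(b+1)] for
    [a > 0] and [b] even is a homotopy between the identity and the projection
    onto the span of the [u^0 v^b] with [b] even. For a monomial [t], [hom] uses
    the first index [i] at which [t] is not fixed by that projection. Applying
    [s] to [t] changes neither this index nor the set of such indices, whence
    [s (hom p) + hom (s p) + rest p = p] (lemma [homotopy]), where [rest]
    projects onto the polynomials in the [v_i ^+ 2]. If [s p = 0], then
    [p = s (hom p) + rest p]; this gives [B = im s + A]. As [hom] raises the
    degree by one and [rest] vanishes in positive degree, every A-linear
    relation between [1] and the [s (vT T)] with [#|T| >= 2] is a combination of
    the Koszul relations
    [\sum_(i in S) u_i * s (vT (S :\ i)) = 0], [#|S| >= 3] (lemma [syzygy]).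

    For the presentation, let [ev] be the map [A[c_T] -> B] with
    [c_T |-> s (vT T)]. It kills each [relation1] because [s (s p) = 0], each
    [relation2] because squaring is additive, and each [relation3] by expanding
    [\sum_(p in T) u_p * s (vT (T :\ p) * vT U)] with the Leibniz rule.
    Modulo [relation2] and [relation3], a product [c_T * c_U] is an A-linear
    combination of [1] and the [c_T], so these span [A[c_T]] modulo [N] (lemma
    [spanned_all]); an A-linear combination of them in the kernel of [ev] is, by
    [syzygy], a combination of the [relation1]. Hence [N] is the kernel of [ev].

    The elements in the lists of generators and relations are told apart by
    evaluating polynomials at points with coordinates 0 and 1. *)

(** * Linear maps given on monomials *)

Section MonomialExtension.
Variables (m : nat) (R : comNzRingType) (V : lmodType R).
Variable f : 'X_{1..m} -> V.

(** The linear map from polynomials to [V] sending each monomial ['X_[t]] to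
    [f t]. *)
Definition monext (p : {mpoly R[m]}) : V := \sum_(t <- msupp p) p@_t *: f t.

Lemma monextwE (p : {mpoly R[m]}) d : (msize p <= d)%N ->
  monext p = \sum_(t : 'X_{1..m < d}) p@_t *: f t.
Proof.
move=> le_pd; pose I : subFinType _ := 'X_{1..m < d}.
rewrite /monext (big_mksub I) ?msupp_uniq //=; first last.
  by move=> x /msize_mdeg_lt /leq_trans; apply.
by rewrite big_rmcond //= => j /memN_msupp_eq0 ->; rewrite scale0r.
Qed.

Lemma monext_is_linear : linear monext.
Proof.
move=> a p q; pose d := maxn (msize (a *: p + q)) (maxn (msize p) (msize q)).
rewrite !(@monextwE _ d) ?leq_max ?leqnn ?orbT // scaler_sumr -big_split /=.
by apply: eq_bigr => t _; rewrite mcoeffD mcoeffZ scalerDl scalerA.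
Qed.

HB.instance Definition _ :=
  GRing.isLinear.Build R {mpoly R[m]} V _ monext monext_is_linear.

Lemma monextX t : monext 'X_[t] = f t.
Proof. by rewrite /monext msuppX big_seq1 mcoeffX eqxx scale1r. Qed.

End MonomialExtension.

Lemma linear_mpoly_ext m (R : comNzRingType) (V : lmodType R)
    (F G : {linear {mpoly R[m]} -> V}) :
  (forall t, F 'X_[t] = G 'X_[t]) -> F =1 G.
Proof.
move=> FG p; rewrite [p]mpolyE !linear_sum; apply: eq_bigr => t _ /=.
by rewrite !linearZ FG.
Qed.

(** * The derivation on monomials *)

Section Monomials.
Variable n : nat.
Implicit Types (i j : 'I_n) (t : 'X_{1..n + n}) (T : {set 'I_n}).

Lemma mnm_uvP t1 t2 :
  (forall i, t1 (lshift n i) = t2 (lshift n i)) ->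
  (forall i, t1 (rshift n i) = t2 (rshift n i)) -> t1 = t2.
Proof.
move=> eq_u eq_v; apply/mnmP => j; rewrite -[j]splitK.
by case: (split j) => i /=.
Qed.

Lemma addk2 (x : k) : x + x = 0.
Proof.
by rewrite -mulr2n -mulr_natl; case: x => [[|[|]] ] //= ?; apply: val_inj.
Qed.

Lemma addCC (p : Cring n) : p + p = 0.
Proof. by apply/mpolyP => t; rewrite mcoeffD addk2 mcoeff0. Qed.

Lemma natrk d : d%:R = (odd d)%:R :> k.
Proof.
by rewrite -[in LHS](odd_double_half d) natrD -addnn natrD addk2 addr0.
Qed.

(** The indices [i] for which [v i] has an odd exponent in [t]: the monomial
    ['X_[t]] is the product of [vT (odds t)] and of a monomial in the [u i] and
    the [v i ^+ 2]. *)
Definition odds t : {set 'I_n} := [set i | odd (t (rshift n i))].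

(** The exponents of [u i], of [v i] and of [vT T]. *)
Definition mu i : 'X_{1..n + n} := U_(lshift n i)%MM.
Definition mv i : 'X_{1..n + n} := U_(rshift n i)%MM.
Definition mvT T : 'X_{1..n + n} := (\sum_(i in T) mv i)%MM.

Lemma mu_u i j : mu i (lshift n j) = (i == j).
Proof. by rewrite mnm1E eq_lshift. Qed.
Lemma mu_v i j : mu i (rshift n j) = 0%N.
Proof. by rewrite mnm1E eq_lrshift. Qed.
Lemma mv_u i j : mv i (lshift n j) = 0%N.
Proof. by rewrite mnm1E eq_rlshift. Qed.
Lemma mv_v i j : mv i (rshift n j) = (i == j).
Proof. by rewrite mnm1E eq_rshift. Qed.

Definition mnmuvE :=
  (@mnmDE, @mnmBE, mu_u, mu_v, mv_u, mv_v, addn0, subn0, add0n).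

Lemma vTE T : vT T = 'X_[mvT T].
Proof. exact: mprodXE. Qed.

Lemma vT0 : vT set0 = 1 :> Cring n.
Proof. exact: big_set0. Qed.

Lemma mvT_u T i : mvT T (lshift n i) = 0%N.
Proof. by rewrite mnm_sumE big1 // => j _; rewrite mv_u. Qed.

Lemma mvT_v T i : mvT T (rshift n i) = (i \in T) :> nat.
Proof.
rewrite mnm_sumE (eq_bigr (fun j => nat_of_bool (j == i))); last first.
  by move=> j _; rewrite mv_v.
case: (boolP (i \in T)) => iT.
  rewrite (bigD1 i) //= eqxx big1 // => j /andP[_ /negbTE ->] //.
by rewrite big1 // => j jT; case: eqP => // ij; rewrite -ij jT in iT.
Qed.

Lemma odds_mvT T : odds (mvT T) = T.
Proof. by apply/setP => i; rewrite inE mvT_v oddb. Qed.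

Lemma s_is_linear : linear (@s n).
Proof.
move=> a p q; rewrite /s scaler_sumr -big_split /=; apply: eq_bigr => i _.
by rewrite mderivD mderivZ mulrDr scalerAr.
Qed.

HB.instance Definition _ :=
  GRing.isLinear.Build k (Cring n) (Cring n) _ (@s n) s_is_linear.

Lemma sM (p q : Cring n) : s (p * q) = s p * q + p * s q.
Proof.
rewrite /s mulr_suml mulr_sumr -big_split /=; apply: eq_bigr => i _.
by rewrite mderivM mulrDr; congr (_ + _); [exact: mulrA | exact: mulrCA].
Qed.

Lemma sX t : s 'X_[t] = \sum_(i in odds t) 'X_[(t - mv i + mu i)%MM].
Proof.
rewrite /s [RHS]big_mkcond; apply: eq_bigr => i _ /=.
rewrite mderivX natrk inE; case: odd; last by rewrite scale0r mulr0.
by rewrite scale1r mpolyXD mulrC.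
Qed.

Lemma odds_step t i : i \in odds t -> odds (t - mv i + mu i)%MM = odds t :\ i.
Proof.
rewrite inE => ti; apply/setP => j; rewrite !inE !mnmuvE.
by case: eqVneq ti => [->|] /= => tj; rewrite ?subn0 //; lia.
Qed.

Lemma s_vT T : s (vT T) = \sum_(i in T) u i * vT (T :\ i).
Proof.
rewrite !vTE sX odds_mvT; apply: eq_bigr => i iT.
rewrite vTE -mpolyXD; congr mpolyX; apply: mnm_uvP => j; rewrite !mnmuvE.
  by rewrite !mvT_u addnC.
by rewrite !mvT_v !inE; case: eqVneq => [<-|]; rewrite ?iT ?subn0.
Qed.

Lemma ss0 (p : Cring n) : s (s p) = 0.
Proof.
have -> : s (s p) = ((@s n) \o (@s n)) p by [].
have -> : 0 = (\0 : Cring n -> Cring n) p by [].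
apply: linear_mpoly_ext => t /=; rewrite sX linear_sum /=.
(* The term [F i j] of [s (s 'X_[t])] is symmetric in [i] and [j], so the sums
   over [i < j] and over [j < i] cancel. *)
pose F i j : Cring n := 'X_[(t - mv i + mu i - mv j + mu j)%MM].
pose L := \sum_(i in odds t) \sum_(j in odds t | (i < j)%N) F i j.
pose U := \sum_(i in odds t) \sum_(j in odds t | (j < i)%N) F i j.
transitivity (L + U).
  rewrite -big_split /=; apply: eq_bigr => i it.
  rewrite sX odds_step //; rewrite [RHS]addrC [LHS](bigID (fun j => (j < i)%N)).
  by congr (_ + _); apply: eq_big => [j|j _] //; rewrite !inE -val_eqE /=; lia.
suff -> : U = L by rewrite addCC.
rewrite /U /L (exchange_big_dep (mem (odds t))) //=; last first.
  by move=> i j _ /andP[].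
apply: eq_bigr => i it.
apply: eq_big => j; first by rewrite it.
move=> /and3P[jt _ ij]; congr mpolyX; move: it jt; rewrite !inE => it jt.
have nij : (i == j) = false by rewrite -val_eqE /=; lia.
have nji : (j == i) = false by rewrite eq_sym.
apply: mnm_uvP => l; rewrite !mnmuvE; first by lia.
by lia.
Qed.

End Monomials.

(** * The contracting homotopy *)

Section Homotopy.
Variable n : nat.
Implicit Types (i j : 'I_n) (t : 'X_{1..n + n}) (T : {set 'I_n}).

(** [active t i]: in [t], either [u i] occurs or [v i] has an odd exponent, i.e.
    the part of ['X_[t]] in [u i] and [v i] is not a power of [v i ^+ 2]. *)
Definition active t i := (0 < t (lshift n i))%N || (i \in odds t).

(** The homotopy on monomials: at the first active index [i], a factor [u i] is
    replaced by [v i] if the exponent of [v i] is even. *)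
Definition homX t : Cring n :=
  if [pick i | active t i] is Some i then
    if i \in odds t then 0 else 'X_[(t - mu i + mv i)%MM]
  else 0.

(** The projection onto the polynomials in the [v i ^+ 2], on monomials. *)
Definition restX t : Cring n :=
  if [pick i | active t i] is Some _ then 0 else 'X_[t].

Definition hom : Cring n -> Cring n := monext homX.
Definition rest : Cring n -> Cring n := monext restX.
HB.instance Definition _ := GRing.Linear.on hom.
HB.instance Definition _ := GRing.Linear.on rest.

Lemma homE t : hom 'X_[t] = homX t.
Proof. exact: monextX. Qed.
Lemma restE t : rest 'X_[t] = restX t.
Proof. exact: monextX. Qed.

Lemma active_step t j : j \in odds t ->
  active (t - mv j + mu j)%MM =1 active t.
Proof.
move=> jt i; rewrite /active odds_step // !inE !mnmuvE.
by move: jt; rewrite inE; case: eqVneq => [->|] /=; lia.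
Qed.

Lemma odds_raise t i : i \notin odds t ->
  odds (t - mu i + mv i)%MM = i |: odds t.
Proof.
rewrite inE => it; apply/setP => j; rewrite !inE !mnmuvE.
by case: eqVneq it => [->|] /= it; rewrite ?subn0 //; lia.
Qed.

(** If [i] is the first active index of [t], then it is also that of every term of
    [s 'X_[t]]. If [v i] has an odd exponent, only the term of [s 'X_[t]] indexed
    by [i] survives under [hom], and gives ['X_[t]] back. If it is even, this
    happens in [s (hom 'X_[t])], whose other terms cancel with
    [hom (s 'X_[t])]. *)
Lemma homotopyX t : s (hom 'X_[t]) + hom (s 'X_[t]) + rest 'X_[t] = 'X_[t].
Proof.
rewrite homE restE sX linear_sum /=.
have pick_step j : j \in odds t ->
    [pick i | active (t - mv j + mu j)%MM i] = [pick i | active t i].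
  by move=> jt; apply: eq_pick; exact: active_step.
(* Every term of [hom (s 'X_[t])] is computed at the same index [i]. *)
rewrite (eq_bigr (fun j =>
    if [pick i | active t i] is Some i then
      if i \in odds t :\ j then 0
      else 'X_[(t - mv j + mu j - mu i + mv i)%MM]
    else 0)); last first.
  move=> j jt; rewrite homE /homX pick_step //.
  by case: pickP => // i _; rewrite odds_step.
rewrite /homX /restX; case: pickP => [i it|no]; last first.
  by rewrite linear0 add0r big1 ?add0r.
rewrite addr0; case: ifP => [iodd|/negbT ieven].
  (* [v i] has an odd exponent *)
  rewrite linear0 add0r (bigD1 i) //= !inE eqxx /=.
  rewrite big1 ?addr0 => [|j /andP[_ ji]].
    congr mpolyX; move: iodd; rewrite inE => iodd.
    by apply: mnm_uvP => j; rewrite !mnmuvE; case: eqVneq iodd => [<-|] /=; lia.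
  by move: iodd; rewrite !inE eq_sym ji => ->.
have ti : (0 < t (lshift n i))%N by move: it; rewrite /active (negbTE ieven) orbF.
(* [v i] has an even exponent and [u i] occurs *)
rewrite sX odds_raise // big_setU1 //= -[RHS]addr0 -addrA.
move: ieven; rewrite inE => ieven.
congr (_ + _).
  congr mpolyX; apply: mnm_uvP => j; rewrite !mnmuvE;
    by case: eqVneq ti => [<-|] /=; lia.
rewrite -[RHS](addCC (\sum_(j in odds t)
  'X_[(t - mu i + mv i - mv j + mu j)%MM])).
congr (_ + _); apply: eq_bigr => j; rewrite !inE => jt.
rewrite (negbTE ieven) andbF; congr mpolyX.
have ij : (i == j) = false by apply/negbTE; apply: contraNneq ieven => ->.
have ji : (j == i) = false by rewrite eq_sym.
apply: mnm_uvP => l; rewrite !mnmuvE.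
  by have [<-|_] := eqVneq i l; rewrite ?ji /=; lia.
by have [<-|_] := eqVneq i l; rewrite ?ji /=; lia.
Qed.

Lemma homotopy (p : Cring n) : s (hom p) + hom (s p) + rest p = p.
Proof.
have -> : s (hom p) + hom (s p) + rest p =
  ((((@s n) \o hom) \+ (hom \o (@s n))) \+ rest) p by [].
rewrite -[RHS]/(idfun p).
by apply: linear_mpoly_ext => t; exact: homotopyX.
Qed.

End Homotopy.

(** * Even monomials and the coefficient ring *)

Section Coordinates.
Variable n : nat.
Implicit Types (i j : 'I_n) (t : 'X_{1..n + n}) (S T : {set 'I_n}).

Lemma inAZ (x : k) (p : Cring n) : p \in inA n -> x *: p \in inA n.
Proof.
by move=> /asboolP[q ->]; apply/asboolP; exists (x *: q); rewrite linearZ.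
Qed.

Lemma inA_sumZ I (r : seq I) (x : I -> k) (F : I -> Cring n) :
  (forall z, F z \in inA n) -> \sum_(z <- r) x z *: F z \in inA n.
Proof. by move=> FA; apply: rpred_sum => z _; apply: inAZ. Qed.

(** The exponents of the value of ['X_[t]] at [Agen n]. *)
Definition dblX t : 'X_{1..n + n} :=
  [multinom match split j with inl _ => t j | inr _ => (t j).*2 end | j < n + n].

Lemma dblX_u t i : dblX t (lshift n i) = t (lshift n i).
Proof. by rewrite mnmE (unsplitK (inl i)). Qed.

Lemma dblX_v t i : dblX t (rshift n i) = (t (rshift n i)).*2.
Proof. by rewrite mnmE (unsplitK (inr i)). Qed.

Lemma comp_AgenX t : 'X_[t] \mPo Agen n = 'X_[dblX t].
Proof.
rewrite comp_mpolyX [RHS]mpolyXE_id !big_split_ord /=.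
congr (_ * _); apply: eq_bigr => i _; rewrite tnth_mktuple.
  by rewrite (unsplitK (inl i)) dblX_u.
by rewrite (unsplitK (inr i)) dblX_v -mul2n exprM.
Qed.

Lemma inA_X t : odds t = set0 -> 'X_[t] \in inA n.
Proof.
move=> t0; apply/asboolP.
exists 'X_[[multinom match split j with inl _ => t j | inr _ => (t j)./2 end
  | j < n + n]].
rewrite comp_AgenX; congr mpolyX; apply: mnm_uvP => i.
  by rewrite dblX_u mnmE (unsplitK (inl i)).
rewrite dblX_v mnmE (unsplitK (inr i)) /=.
have : i \notin odds t by rewrite t0 inE.
by rewrite inE => /even_halfK ->.
Qed.

Lemma rest_inA p : rest p \in inA n.
Proof.
apply: inA_sumZ => t; rewrite /restX; case: pickP => [_ _|no]; first exact: rpred0.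
apply: inA_X; apply/setP => i; rewrite [RHS]inE.
by have := no i; rewrite /active => /norP[_ /negbTE].
Qed.

Lemma Aval_sum I (r : seq I) (P : pred I) (F : I -> Aring n) :
  Aval (\sum_(z <- r | P z) F z) = \sum_(z <- r | P z) Aval (F z).
Proof. exact: (big_morph (@Aval n)). Qed.

Lemma Aval_prod I (r : seq I) (P : pred I) (F : I -> Aring n) :
  Aval (\prod_(z <- r | P z) F z) = \prod_(z <- r | P z) Aval (F z).
Proof. exact: (big_morph (@Aval n)). Qed.

Lemma s_inA p : p \in inA n -> s p = 0.
Proof. by move=> pA; apply/eqP; have := inA_kers (MkA pA); rewrite inE. Qed.

Lemma sA (a : Aring n) p : s (Aval a * p) = Aval a * s p.
Proof. by rewrite sM s_inA ?mul0r ?add0r //; case: a. Qed.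

(** [coord T p] is the coefficient of [p] at the basis element [vT T], over the
    subring generated by the [u i] and [v i ^+ 2]; [coordX T] gives it on
    monomials. *)
Definition coordX T t : Cring n :=
  if odds t == T then 'X_[(t - mvT T)%MM] else 0.
Definition coord T : Cring n -> Cring n := monext (coordX T).
HB.instance Definition _ T := GRing.Linear.on (coord T).

Lemma coordE T t : coord T 'X_[t] = coordX T t.
Proof. exact: monextX. Qed.

Lemma odds_sub t : odds (t - mvT (odds t))%MM = set0.
Proof.
apply/setP => i; rewrite inE mnmBE mvT_v !inE.
by case t_odd: (odd (t (rshift n i))) => /=; lia.
Qed.

Lemma coord_inA T p : coord T p \in inA n.
Proof.
apply: inA_sumZ => t; rewrite /coordX; case: eqP => [<-|_]; last exact: rpred0.
by apply: inA_X; exact: odds_sub.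
Qed.

(** [coord T p] as an element of [Aring n]. *)
Definition coordA T p : Aring n := MkA (coord_inA T p).

Lemma coord_sum p : p = \sum_T coord T p * vT T.
Proof.
pose G q := \sum_T coord T q * vT T.
have G_linear : linear G.
  move=> a x y; rewrite /G scaler_sumr -big_split /=; apply: eq_bigr => T _.
  by rewrite linearP mulrDl scalerAl.
pose GL := GRing.isLinear.Build k _ _ _ G G_linear.
pose G' : {linear Cring n -> Cring n} := HB.pack G GL.
rewrite -[LHS]/(idfun p); apply: (@linear_mpoly_ext _ _ _ idfun G') => t /=.
rewrite /G (bigD1 (odds t)) //= big1 => [|T /negbTE tT]; last first.
  by rewrite coordE /coordX eq_sym tT mul0r.
rewrite addr0 coordE /coordX eqxx vTE -mpolyXD submK //.
apply/mnm_lepP => j; rewrite -[j]splitK; case: (split j) => i /=.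
  by rewrite mvT_u.
by rewrite mvT_v inE /=; case: (t _) => // d; case: odd.
Qed.

Lemma odds_dblD t T : odds (dblX t + mvT T)%MM = T.
Proof.
by apply/setP => i; rewrite inE mnmDE dblX_v mvT_v oddD odd_double addFb oddb.
Qed.

(** Together with [coord_sum]: the ring is free over [Aring n] on the [vT T]. *)
Lemma coord_AvT S T (a : Aring n) :
  coord S (Aval a * vT T) = if S == T then Aval a else 0.
Proof.
case: a => p /= /asboolP[q ->]; rewrite [q]mpolyE.
rewrite raddf_sum mulr_suml linear_sum /=.
case: eqVneq => [->|ST]; last rewrite big1 //.
  apply: eq_bigr => t _; rewrite comp_mpolyZ -scalerAl linearZ /= comp_AgenX.
  by rewrite vTE -mpolyXD coordE /coordX odds_dblD eqxx addmK.
move=> t _; rewrite comp_mpolyZ -scalerAl linearZ /= comp_AgenX.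
by rewrite vTE -mpolyXD coordE /coordX odds_dblD eq_sym (negbTE ST) scaler0.
Qed.

End Coordinates.

(** * Exactness of the derivation *)

Section Exactness.
Variable n : nat.
Implicit Types (i j : 'I_n) (t : 'X_{1..n + n}) (S T : {set 'I_n}).

(** [vdeg d p]: [p] is a combination, with coefficients in [Aring n], of the
    [vT T] with [d <= #|T|]. *)
Definition vdeg d (p : Cring n) := all (fun t => d <= #|odds t|)%N (msupp p).

Lemma vdeg_sum d I (r : seq I) (P : pred I) (F : I -> Cring n) :
  (forall z, P z -> vdeg d (F z)) -> vdeg d (\sum_(z <- r | P z) F z).
Proof.
move=> dF; elim/big_rec: _ => [|z p Pz dp]; first by rewrite /vdeg msupp0.
apply/allP => t /msuppD_le; rewrite mem_cat => /orP[] tF.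
  exact: (allP (dF z Pz)).
exact: (allP dp).
Qed.

Lemma vdegZ d (x : k) p : vdeg d p -> vdeg d (x *: p).
Proof. by move=> dp; apply/allP => t /msuppZ_le; exact: (allP dp). Qed.

Lemma vdegX d t : vdeg d 'X_[t] = (d <= #|odds t|)%N.
Proof. by rewrite /vdeg msuppX /= andbT. Qed.

Lemma vdeg0 d : vdeg d 0.
Proof. by rewrite /vdeg msupp0. Qed.

Lemma vdeg_AvT d T (a : Aring n) : (d <= #|T|)%N -> vdeg d (Aval a * vT T).
Proof.
move=> dT; case: a => p /= /asboolP[q ->]; rewrite [q]mpolyE.
rewrite raddf_sum mulr_suml; apply: vdeg_sum => t _ /=.
rewrite comp_mpolyZ -scalerAl; apply: vdegZ.
by rewrite comp_AgenX vTE -mpolyXD vdegX odds_dblD.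
Qed.

Lemma vdeg_monext d e (f : 'X_{1..n + n} -> Cring n) p :
  (forall t, (d <= #|odds t|)%N -> vdeg e (f t)) ->
  vdeg d p -> vdeg e (monext f p).
Proof.
move=> df dp; rewrite /monext big_seq; apply: vdeg_sum => t tp.
by apply: vdegZ; apply: df; exact: (allP dp).
Qed.

Lemma vdeg_s d p : vdeg d.+1 p -> vdeg d (s p).
Proof.
have -> : s p = monext (fun t => s 'X_[t]) p.
  apply: (@linear_mpoly_ext _ _ _ (@s n) (monext (fun t => s 'X_[t]))) => t.
  by rewrite /= monextX.
apply: vdeg_monext => t dt; rewrite sX; apply: vdeg_sum => i it.
by rewrite vdegX odds_step // -ltnS; move: dt; rewrite (cardsD1 i) it.
Qed.

Lemma vdeg_hom d p : vdeg d p -> vdeg d.+1 (hom p).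
Proof.
apply: vdeg_monext => t dt; rewrite /homX; case: pickP => [i _|_]; last exact: vdeg0.
case: ifP => [_|/negbT it]; first exact: vdeg0.
by rewrite vdegX odds_raise // cardsU1 it.
Qed.

Lemma rest_vdeg d p : vdeg d.+1 p -> rest p = 0.
Proof.
move=> dp; rewrite /rest /monext big_seq big1 // => t tp; rewrite /restX.
case: pickP => [|no]; first by rewrite scaler0.
have /card_gt0P[i it] : (0 < #|odds t|)%N by exact: leq_trans (allP dp t tp).
by have := no i; rewrite /active it orbT.
Qed.

Lemma coord_vdeg d p T : vdeg d p -> (#|T| < d)%N -> coord T p = 0.
Proof.
move=> dp Td; rewrite /coord /monext big_seq big1 // => t tp; rewrite /coordX.
case: eqP => [tT|_]; last by rewrite scaler0.
by have := allP dp t tp; rewrite tT leqNgt Td.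
Qed.

Lemma kers_decomp (p : Cring n) : s p = 0 -> p = s (hom p) + rest p.
Proof. by move=> sp; rewrite -{1}[p]homotopy sp linear0 addr0. Qed.

Lemma kers_vdeg d (p : Cring n) : s p = 0 -> vdeg d.+1 p ->
  exists2 q, vdeg d.+2 q & p = s q.
Proof.
move=> sp dp; exists (hom p); first exact: vdeg_hom.
by rewrite {1}(kers_decomp sp) (rest_vdeg dp) addr0.
Qed.

(** The A-linear relations between 1 and the [s (vT T)] are the Koszul ones: up
    to a reindexing, they are combinations of the relations
    [\sum_(i in S) u i * s (vT (S :\ i)) = 0] with [3 <= #|S|]. *)
Lemma syzygy (a0 : Aring n) (a : {set 'I_n} -> Aring n) :
  Aval a0 + \sum_(T | large T) Aval (a T) * s (vT T) = 0 ->
  a0 = 0 /\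
  exists b : {set 'I_n} -> Aring n, forall T, large T ->
    a T = \sum_(S : {set 'I_n} | (3 <= #|S|)%N)
            \sum_(i in S | S :\ i == T) b S * uA i.
Proof.
pose p := \sum_(T | large T) Aval (a T) * vT T.
have dp : vdeg 2 p by apply: vdeg_sum => T; exact: vdeg_AvT.
have -> : \sum_(T | large T) Aval (a T) * s (vT T) = s p.
  by rewrite linear_sum; apply: eq_bigr => T _; rewrite /= sA.
move=> a0p; have a00 : a0 = 0.
  apply: val_inj => /=.
  have := congr1 (coord set0) a0p; rewrite linearD linear0 /=.
  rewrite (@coord_vdeg 1 (s p)) ?cards0 ?vdeg_s // addr0.
  by rewrite -[Aval a0]mulr1 -vT0 coord_AvT eqxx vT0 mulr1.
split=> //; have [||q dq pq] := @kers_vdeg 1 p; rewrite ?dp //.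
  by rewrite -[RHS]a0p a00 add0r.
exists (fun S => coordA S q) => T lT; apply: val_inj => /=.
have -> : Aval (a T) = coord T p.
  rewrite /p linear_sum (bigD1 T) //= coord_AvT eqxx big1 ?addr0 // => S /andP[_ ST].
  by rewrite coord_AvT eq_sym (negbTE ST).
have sq : s q = \sum_S Aval (coordA S q) * s (vT S).
  rewrite {1}[q]coord_sum (linear_sum (@s n)); apply: eq_bigr => S _ /=.
  by rewrite -[coord S q]/(Aval (coordA S q)) sA.
rewrite pq sq (linear_sum (coord T)) Aval_sum.
rewrite [RHS]big_mkcond; apply: eq_bigr => S _ /=.
rewrite s_vT mulr_sumr (linear_sum (coord T)).
case: leqP => [S2|_].
  by rewrite big1 // => i iS /=; rewrite (coord_vdeg dq) ?mul0r ?linear0.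
rewrite Aval_sum big_mkcondr /=; apply: eq_bigr => i iS.
by rewrite mulrA -[_ * u i]/(Aval (coordA S q * uA i)) coord_AvT eq_sym.
Qed.

End Exactness.

(** * The evaluation map and the relations *)

Section Evaluation.
Variable n : nat.
Implicit Types (i j : 'I_n) (S T U : {set 'I_n}).

Fact AtoB_additive : zmod_morphism (@AtoB n).
Proof. by move=> a b; apply: val_inj. Qed.
Fact AtoB_multiplicative : monoid_morphism (@AtoB n).
Proof. by split=> [|a b]; apply: val_inj. Qed.
HB.instance Definition _ := GRing.isZmodMorphism.Build (Aring n) (Bring n)
  (@AtoB n) AtoB_additive.
HB.instance Definition _ := GRing.isMonoidMorphism.Build (Aring n) (Bring n)
  (@AtoB n) AtoB_multiplicative.

Fact s_kers (p : Cring n) : s p \in kers n.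
Proof. by rewrite inE ss0. Qed.

(** [s (vT T)] as an element of [Bring n]. *)
Definition sB T : Bring n := MkB (s_kers (vT T)).

(** The morphism of A-algebras [A[c_T] -> B] with [c_T |-> s (vT T)]. *)
Definition ev : Acring n -> Bring n :=
  mmap (@AtoB n) (fun e => sB (val (enum_val e))).
HB.instance Definition _ := GRing.RMorphism.on ev.

Lemma evZ (a : Aring n) x : ev (a *: x) = AtoB a * ev x.
Proof. exact: mmapZ. Qed.

Lemma evC (a : Aring n) : ev a%:MP = AtoB a.
Proof. exact: mmapC. Qed.

Lemma Bval_sum I (r : seq I) (P : pred I) (F : I -> Bring n) :
  Bval (\sum_(z <- r | P z) F z) = \sum_(z <- r | P z) Bval (F z).
Proof. exact: (big_morph (@Bval n)). Qed.

Lemma c_large (t : largeset n) : c (val t) = 'X_(enum_rank t).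
Proof. by rewrite /c valK. Qed.

Lemma c_small T : ~~ large T -> c T = (\sum_(i in T) uA i)%:MP.
Proof. by move=> sT; rewrite /c insubN. Qed.

Lemma s_vT_small T : ~~ large T -> s (vT T) = Aval (\sum_(i in T) uA i).
Proof.
move=> sT; rewrite Aval_sum s_vT; apply: eq_bigr => i iT.
suff -> : T :\ i = set0 by rewrite vT0 mulr1.
by apply: cards0_eq; move: sT; rewrite /large (cardsD1 i) iT; lia.
Qed.

Lemma ev_c T : ev (c T) = sB T.
Proof.
case: (boolP (large T)) => [lT|sT].
  rewrite -[T]/(val (Sub T lT : largeset n)) c_large /ev mmapX mmap1U.
  by rewrite enum_rankK.
by rewrite c_small // evC; apply: val_inj; rewrite /= s_vT_small.
Qed.

Lemma ev_relation1 T : ev (relation1 T) = 0.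
Proof.
rewrite rmorph_sum; apply: val_inj; rewrite /= Bval_sum -[RHS](ss0 (vT T)) s_vT.
rewrite (linear_sum (@s n)); apply: eq_bigr => i _ /=.
by rewrite evZ ev_c /= -[u i]/(Aval (uA i)) sA.
Qed.

Lemma ev_relation2 i j : i != j -> ev (relation2 i j) = 0.
Proof.
move=> ij; rewrite rmorphD rmorphXn /= ev_c evC; apply: val_inj => /=.
rewrite s_vT big_setU1 ?inE //= big_set1 setU1K ?inE //.
have -> : [set i; j] :\ j = [set i] by rewrite setUC setU1K // inE eq_sym.
have sqD (x y : Cring n) : (x + y) * (x + y) = x * x + y * y.
  by rewrite -!expr2 sqrrD mulr2n addCC addr0.
rewrite /vT !big_set1 sqD mulrACA [u j * _ * _]mulrACA !expr2; exact: addCC.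
Qed.

Lemma vT_symdiff S U :
  vT S * vT U = (\prod_(q in S :&: U) v q ^+ 2) * vT (symdiff S U) :> Cring n.
Proof.
rewrite /vT (big_setID U) /= [X in _ * X](big_setID S) /=.
rewrite [X in _ = _ * X](big_setID U) /= [U :&: S]setIC.
have -> : symdiff S U :&: U = U :\: S.
  by apply/setP => i; rewrite !inE; case: (i \in S) (i \in U) => [] [].
have -> : symdiff S U :\: U = S :\: U.
  by apply/setP => i; rewrite !inE; case: (i \in S) (i \in U) => [] [].
rewrite mulrACA [X in _ * X]mulrC; congr (_ * _).
by rewrite -big_split /=; apply: eq_bigr => i _; rewrite expr2.
Qed.

Lemma ev_relation3 T U : ev (relation3 T U) = 0.
Proof.
rewrite rmorphD rmorphM rmorph_sum /= !ev_c; apply: val_inj => /=.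
rewrite Bval_sum; have sT := ss0 (vT T).
(* In [\sum_p u p * s (vT (T :\ p) * vT U)], the terms
   [u p * s (vT (T :\ p)) * vT U] of the Leibniz rule add up to
   [s (s (vT T)) * vT U = 0]. *)
have -> : s (vT T) * s (vT U) = \sum_(p in T) u p * s (vT (T :\ p) * vT U).
  under eq_bigr do rewrite sM mulrDr !mulrA.
  rewrite big_split /= {1}s_vT -[LHS]add0r; congr (_ + _); last exact: mulr_suml.
  rewrite -[LHS](mul0r (vT U)) -[in LHS]sT s_vT (linear_sum (@s n)) mulr_suml.
  by apply: eq_bigr => p _; rewrite /= -[u p]/(Aval (uA p)) sA.
rewrite -big_split big1 //= => p _; rewrite evZ ev_c /= vT_symdiff.
have -> : (T :\ p) :&: U = (T :&: U) :\ p by rewrite setIDAC.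
rewrite -[\prod_(q in _) _ ^+ 2]/(\prod_(q in (T :&: U) :\ p) Aval (v2A q)).
rewrite -Aval_prod sA mulrA; exact: addCC.
Qed.

Lemma ev_N x : x \in N n -> ev x = 0.
Proof.
move=> /asboolP[h ->]; rewrite rmorph_sum big1 // => i _; rewrite rmorphM /=.
suff -> : ev (relations n)`_i = 0 by rewrite mulr0.
have := mem_nth 0 (ltn_ord i); rewrite !mem_cat => /or3P[] /imageP[].
- by move=> T _ ->; exact: ev_relation1.
- move=> [a b]; rewrite inE /= => ab ->; apply: ev_relation2.
  by rewrite -val_eqE /= ltn_eqF.
- by move=> [T U] _ ->; exact: ev_relation3.
Qed.

Lemma relations_N x : x \in relations n -> x \in N n.
Proof.
move=> xr; apply/asboolP; have xi : (index x (relations n) < size (relations n))%N.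
  by rewrite index_mem.
exists (fun z => (z == Ordinal xi)%:R); rewrite (bigD1 (Ordinal xi)) //= eqxx mul1r.
by rewrite nth_index // big1 ?addr0 // => z /negbTE ->; rewrite mul0r.
Qed.

Lemma relation1_N T : (3 <= #|T|)%N -> relation1 T \in N n.
Proof.
move=> T3; apply: relations_N; rewrite !mem_cat; apply/orP; left.
by apply: image_f; rewrite inE.
Qed.

Lemma relation2_N i j : (i < j)%N -> relation2 i j \in N n.
Proof.
move=> ij; apply: relations_N; rewrite !mem_cat; apply/orP; right; apply/orP; left.
by apply/imageP; exists (i, j); rewrite ?inE.
Qed.

Lemma relation3_N T U : large T -> large U ->
  (#|T| == 2%N) && (#|U| == 2%N) ==> (T != U) -> relation3 T U \in N n.
Proof.
move=> lT lU TU; apply: relations_N; rewrite !mem_cat; apply/orP; right.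
by apply/orP; right; apply/imageP; exists (T, U); rewrite ?inE //= lT lU.
Qed.

(** * The quotient is spanned by the unit and the classes of the c_T *)

(** The general A-linear combination of 1 and the [c T], [T] large. *)
Definition comb (a0 : Aring n) (w : {set 'I_n} -> Aring n) : Acring n :=
  a0%:MP + \sum_(T | large T) w T *: c T.

(** [x] is congruent modulo [N n] to an A-linear combination of 1 and the
    [c T]. *)
Definition spanned (x : Acring n) := exists a0 w, x - comb a0 w \in N n.

Lemma spanned_N x : x \in N n -> spanned x.
Proof.
move=> xN; exists 0, (fun=> 0); rewrite /comb mpolyC0 add0r big1 ?subr0 //.
by move=> T _; rewrite scale0r.
Qed.

Lemma spannedC (a : Aring n) : spanned a%:MP.
Proof.
exists a, (fun=> 0); rewrite /comb big1 ?addr0 ?subrr ?rpred0 //.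
by move=> T _; rewrite scale0r.
Qed.

Lemma spannedD x y : spanned x -> spanned y -> spanned (x + y).
Proof.
move=> [a0 [w xw]] [a0' [w' yw]]; exists (a0 + a0'), (fun T => w T + w' T).
suff -> : comb (a0 + a0') (fun T => w T + w' T) = comb a0 w + comb a0' w'.
  by rewrite opprD addrACA rpredD.
rewrite /comb mpolyCD -addrACA -big_split /=; congr (_ + _).
by apply: eq_bigr => T _; rewrite scalerDl.
Qed.

Lemma spannedZ (a : Aring n) x : spanned x -> spanned (a *: x).
Proof.
move=> [a0 [w xw]]; exists (a * a0), (fun T => a * w T).
suff -> : comb (a * a0) (fun T => a * w T) = a *: comb a0 w.
  by rewrite -scalerBr -mul_mpolyC idealMr.
rewrite /comb scalerDr scaler_sumr mpolyCM mul_mpolyC; congr (_ + _).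
by apply: eq_bigr => T _; rewrite scalerA.
Qed.

Lemma spannedB x y : spanned x -> spanned y -> spanned (x - y).
Proof. by move=> xs ys; rewrite -scaleN1r; apply: spannedD => //; exact: spannedZ. Qed.

Lemma spanned_sum I (r : seq I) (P : pred I) (F : I -> Acring n) :
  (forall z, P z -> spanned (F z)) -> spanned (\sum_(z <- r | P z) F z).
Proof.
by move=> Fs; apply: big_ind => //; [exact/spanned_N/rpred0 | exact: spannedD].
Qed.

Lemma spanned_c T : spanned (c T).
Proof.
case: (boolP (large T)) => [lT|sT]; last by rewrite c_small //; exact: spannedC.
exists 0, (fun S => (S == T)%:R); rewrite /comb mpolyC0 add0r (bigD1 T) //=.
rewrite eqxx scale1r big1 ?addr0 ?subrr ?rpred0 // => S /andP[_ /negbTE ->].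
by rewrite scale0r.
Qed.

Lemma spanned_cc T U : large T -> large U -> spanned (c T * c U).
Proof.
move=> lT lU; case: (boolP ((#|T| == 2%N) && (#|U| == 2%N) ==> (T != U))) => [TU|].
  rewrite -[c T * c U](addrK (\sum_(p in T)
    (uA p * \prod_(q in (T :&: U) :\ p) v2A q) *: c (symdiff (T :\ p) U))).
  apply: spannedB; first exact/spanned_N/relation3_N.
  by apply: spanned_sum => p _; apply: spannedZ; exact: spanned_c.
rewrite negb_imply negbK => /andP[/andP[/cards2P[i [j [ij ->]]] _] /eqP <-].
rewrite -expr2; wlog : i j ij / (i < j)%N => [IH|lt_ij].
  move: (ij); rewrite neq_ltn => /orP[] lt_ij; first exact: IH.
  by rewrite setUC; apply: IH; rewrite // eq_sym.
rewrite -[_ ^+ 2](addrK (uA i ^+ 2 * v2A j + uA j ^+ 2 * v2A i)%:MP).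
by apply: spannedB; [exact/spanned_N/relation2_N | exact: spannedC].
Qed.

Lemma spanned_cM T x : large T -> spanned x -> spanned (c T * x).
Proof.
move=> lT [a0 [w xw]]; rewrite -[x](subrK (comb a0 w)) mulrDr.
apply: spannedD; first by apply: spanned_N; rewrite idealMr.
rewrite mulrDr mulr_sumr mulrC mul_mpolyC; apply: spannedD.
  by apply: spannedZ; exact: spanned_c.
by apply: spanned_sum => U lU; rewrite -scalerAr; apply: spannedZ; exact: spanned_cc.
Qed.

Lemma spannedX (t : 'X_{1..#|{: largeset n}|}) : spanned 'X_[t].
Proof.
(* The set of [y] for which multiplication by [y] preserves [spanned] is closed
   under products. *)
pose good y := forall x, spanned x -> spanned (y * x).
have good1 : good 1 by move=> x; rewrite mul1r.
have goodM y z : good y -> good z -> good (y * z).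
  by move=> gy gz x xs; rewrite -mulrA; exact/gy/gz.
rewrite -['X_[t]]mulr1; suff : good 'X_[t] by apply; exact: (spannedC 1).
rewrite mpolyXE_id; apply: (big_ind good) => // j _.
elim: (t j) => [|d IH]; first by rewrite expr0.
rewrite exprS; apply: goodM => // x xs.
rewrite -[j]enum_valK -c_large; apply: spanned_cM => //; exact: valP.
Qed.

Lemma spanned_all x : spanned x.
Proof.
rewrite [x]mpolyE; apply: spanned_sum => t _; apply: spannedZ; exact: spannedX.
Qed.

Lemma ev_comb a0 w :
  Bval (ev (comb a0 w)) = Aval a0 + \sum_(T | large T) Aval (w T) * s (vT T).
Proof.
rewrite rmorphD rmorph_sum /= evC Bval_sum; congr (_ + _).
by apply: eq_bigr => T _; rewrite evZ ev_c.
Qed.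

(** The kernel of [ev] is contained in [N n]. *)
Lemma ev_eq0 x : ev x = 0 -> x \in N n.
Proof.
move=> x0; have [a0 [w xw]] := spanned_all x.
rewrite -[x](subrK (comb a0 w)) rpredD //.
have : Bval (ev (comb a0 w)) = 0.
  by have := ev_N xw; rewrite rmorphB /= x0 sub0r => /eqP; rewrite oppr_eq0 => /eqP ->.
rewrite ev_comb => /syzygy[-> [b bw]].
suff -> : comb 0 w = \sum_(S : {set 'I_n} | (3 <= #|S|)%N) b S *: relation1 S.
  by apply: rpred_sum => S S3; rewrite -mul_mpolyC idealMr ?relation1_N.
rewrite /comb mpolyC0 add0r.
under eq_bigr => T lT do rewrite bw // scaler_suml.
rewrite exchange_big /=; apply: eq_bigr => S S3; rewrite scaler_sumr.
rewrite (partition_big (fun i => S :\ i) (@large n)) /=; last first.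
  by move=> i iS; move: S3; rewrite /large (cardsD1 i) iS.
apply: eq_bigr => T _; rewrite scaler_suml; apply: eq_bigr => i /andP[_ /eqP <-].
by rewrite scalerA.
Qed.

(** * The isomorphism *)

(** The map induced by [ev] on the quotient. *)
Definition qmap (x : Qring n) : Bring n := ev (repr x).

Lemma qmap_pi x : qmap (\pi_(Qring n) x) = ev x.
Proof.
apply/eqP; rewrite -subr_eq0 -rmorphB; apply/eqP/ev_N.
by rewrite Quotient.idealrBE reprK.
Qed.

Fact qmap_additive : zmod_morphism qmap.
Proof.
by move=> x y; rewrite -[x]reprK -[y]reprK -rmorphB !qmap_pi rmorphB.
Qed.
Fact qmap_multiplicative : monoid_morphism qmap.
Proof.
split=> [|x y]; first by rewrite -(rmorph1 (\pi_(Qring n))) qmap_pi rmorph1.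
by rewrite -[x]reprK -[y]reprK -rmorphM !qmap_pi rmorphM.
Qed.
Fact qmap_scalable : scalable qmap.
Proof.
by move=> a x; rewrite -[x]reprK -[_ *: _]rmorphM !qmap_pi rmorphM /= evC.
Qed.

HB.instance Definition _ := GRing.isZmodMorphism.Build (Qring n) (Bring n)
  qmap qmap_additive.
HB.instance Definition _ := GRing.isMonoidMorphism.Build (Qring n) (Bring n)
  qmap qmap_multiplicative.
HB.instance Definition _ := GRing.isScalable.Build (Aring n) (Qring n) (Bring n)
  _ qmap qmap_scalable.

Lemma qmap_inj : injective qmap.
Proof.
move=> x y; rewrite -[x]reprK -[y]reprK !qmap_pi => xy.
by apply/eqP; rewrite -Quotient.idealrBE ev_eq0 // rmorphB /= xy subrr.
Qed.

(** The kernel of [s] is spanned over [Aring n] by 1 and the [s (vT T)], [T]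
    large; the other [s (vT T)] are 0 or some [u i], hence in [Aring n]. *)
Lemma kers_span (p : Cring n) : s p = 0 ->
  exists (a0 : Aring n) w, p = Aval a0 + \sum_(T | large T) Aval (w T) * s (vT T).
Proof.
move=> sp; pose q := hom p.
exists (MkA (rest_inA p)
        + \sum_(T | ~~ large T) coordA T q * \sum_(i in T) uA i).
exists (fun T => coordA T q).
rewrite [LHS](kers_decomp sp) addrC -addrA; congr (_ + _).
rewrite -/q [q in LHS]coord_sum (linear_sum (@s n)) (bigID (@large n)) /= addrC.
rewrite Aval_sum; congr (_ + _); apply: eq_bigr => T lT.
  by rewrite -[coord T q]/(Aval (coordA T q)) sA s_vT_small.
by rewrite -[coord T q]/(Aval (coordA T q)) sA.
Qed.

Lemma qmap_surj b : exists x, qmap x = b.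
Proof.
case: b => p pk; have /eqP/kers_span[a0 [w pw]] := pk.
exists (\pi_(Qring n) (comb a0 w)); rewrite qmap_pi; apply: val_inj.
by rewrite [LHS]ev_comb.
Qed.

Lemma qmap_bij : bijective qmap.
Proof.
pose g b := sval (cid (qmap_surj b)).
have gK : cancel g qmap by move=> b; rewrite /g; case: cid.
by exists g => // x; apply: qmap_inj; rewrite gK.
Qed.

End Evaluation.

(** * Counting and irredundancy *)

Section Counting.
Variable n : nat.
Implicit Types (i j : 'I_n) (S T U : {set 'I_n}).

Lemma card_sets_ge d : #|[set T : {set 'I_n} | (d <= #|T|)%N]| =
  ('C(n, d) + #|[set T : {set 'I_n} | (d < #|T|)%N]|)%N.
Proof.
rewrite -[in 'C(n, d)](card_ord n) -card_draws -cardsUI.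
have -> : [set T : {set 'I_n} | #|T| == d] :&: [set T : {set 'I_n} | (d < #|T|)%N]
    = set0 by apply/setP => T; rewrite !inE; case: ltngtP.
rewrite cards0 addn0; apply: eq_card => T.
by rewrite !inE leq_eqVlt eq_sym.
Qed.

Lemma card_sets_ge1 : #|[set T : {set 'I_n} | (0 < #|T|)%N]| = (2 ^ n - 1)%N.
Proof.
have := card_sets_ge 0; rewrite bin0 => E; apply/eqP; rewrite -(eqn_add2l 1) -E.
have -> : [set T : {set 'I_n} | (0 <= #|T|)%N] = powerset setT.
  by apply/setP => T; rewrite !inE subsetT.
by rewrite card_powerset cardsT card_ord subnKC ?expn_gt0.
Qed.

Lemma card_sets_large : #|[set T : {set 'I_n} | large T]| = (2 ^ n - n - 1)%N.
Proof.
have := card_sets_ge 1; rewrite card_sets_ge1 bin1.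
rewrite -[#|[set T | large T]|]/#|[set T : {set 'I_n} | (1 < #|T|)%N]|.
by move: #|_| => m; lia.
Qed.

Lemma card_sets_ge3 : #|[set T : {set 'I_n} | (3 <= #|T|)%N]| =
  (2 ^ n - (n * (n - 1)) %/ 2 - n - 1)%N.
Proof.
have := card_sets_ge 2.
rewrite -[#|[set T : {set 'I_n} | (1 < #|T|)%N]|]/#|[set T | large T]|.
by rewrite card_sets_large divn2 (subn1 n) -bin2; lia.
Qed.

Lemma card_largeset : #|{: largeset n}| = (2 ^ n - n - 1)%N.
Proof. by rewrite -card_sets_large card_sig; apply: eq_card => T; rewrite inE. Qed.

Lemma card_ltn_pairs :
  #|[set ij : 'I_n * 'I_n | (ij.1 < ij.2)%N]| = ((n * (n - 1)) %/ 2)%N.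
Proof.
rewrite divn2 (subn1 n) -bin2 -bin2_sum big_mkord -sum1_card.
rewrite (eq_bigl (fun ij : 'I_n * 'I_n => true && (ij.1 < ij.2)%N)); last first.
  by move=> ij; rewrite inE.
rewrite -(pair_big_dep xpredT (fun i j => (i < j)%N) (fun _ _ => 1%N)) /=.
rewrite (exchange_big_dep xpredT) //=; apply: eq_bigr => j _.
by rewrite -(big_ord_widen n (fun=> 1%N) (ltnW (ltn_ord j))) sum1_card card_ord.
Qed.

Lemma size_relations3 : size (relations3 n) =
  ((2 ^ n - n - 1) ^ 2 - (n * (n - 1)) %/ 2)%N.
Proof.
rewrite size_image -card_sets_large.
set L := [set T : {set 'I_n} | large T].
(* The excluded pairs are the [(T, T)] with [#|T| = 2]. *)
pose D := [set (T, T) | T in [set T : {set 'I_n} | #|T| == 2%N]].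
have cD : #|D| = ((n * (n - 1)) %/ 2)%N.
  rewrite card_imset; last by move=> T U [].
  by rewrite card_draws card_ord bin2 divn2 (subn1 n).
have DL : D \subset setX L L.
  apply/subsetP => _ /imsetP[T T2 ->].
  by rewrite inE in T2; rewrite !inE /large (eqP T2).
rewrite -cD expnS expn1 -cardsX -(cardsDS DL); apply: eq_card => -[T U].
have TUD : ((T, U) \in D) = (#|T| == 2%N) && (T == U).
  apply/imsetP/andP => [[S]|[T2 /eqP <-]]; last by exists T; rewrite ?inE.
  by rewrite inE => S2 [-> ->].
rewrite [RHS]inE TUD !inE /= [RHS]andbC -andbA; congr [&& _, _ & _].
by case: (eqVneq T U) => [<-|_]; rewrite ?andbb ?andbT ?andbF ?implybF ?implybT.
Qed.

(** The point at which [u i = 1], the other [u j] vanish and [v j = 1] exactly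
    when [j \in U]. *)
Definition pt i U (e : 'I_(n + n)) : k :=
  match split e with inl j => (j == i)%:R | inr j => (j \in U)%:R end.

Lemma meval_u i U j : (u j).@[pt i U] = (j == i)%:R.
Proof. by rewrite mevalXU /pt (unsplitK (inl j)). Qed.

Lemma meval_v i U j : (v j).@[pt i U] = (j \in U)%:R.
Proof. by rewrite mevalXU /pt (unsplitK (inr j)). Qed.

Lemma meval_vT i U T : (vT T).@[pt i U] = (T \subset U)%:R.
Proof.
rewrite rmorph_prod /=; under eq_bigr do rewrite meval_v.
case: subsetP => [TU|/subsetP/subsetPn[j jT jU]].
  by rewrite big1 // => j /TU ->.
by rewrite (bigD1 j) //= (negbTE jU) mul0r.
Qed.

Lemma meval_s_vT i U T : (s (vT T)).@[pt i U] = ((i \in T) && (T :\ i \subset U))%:R.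
Proof.
rewrite s_vT rmorph_sum /=; under eq_bigr do rewrite rmorphM /= meval_u meval_vT.
case: (boolP (i \in T)) => iT /=; last first.
  rewrite big1 // => j jT; case: eqP => [ji|]; last by rewrite mul0r.
  by rewrite -ji jT in iT.
rewrite (bigD1 i) //= eqxx mul1r big1 ?addr0 // => j /andP[_ /negbTE ->].
by rewrite mul0r.
Qed.

Lemma s_vT_inj T U : T != set0 -> U != set0 -> s (vT T) = s (vT U) -> T = U.
Proof.
have half S1 S2 : S1 != set0 -> s (vT S1) = s (vT S2) -> S2 \subset S1.
  move=> /set0Pn[i iS] /(congr1 (meval (pt i (S1 :\ i)))).
  rewrite (meval_s_vT _ _ S1) (meval_s_vT _ _ S2) iS subxx /=.
  case: andP => [[iS2 sub] _|_ /eqP]; last first.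
    by rewrite oner_eq0.
  by rewrite -(setD1K iS2) -(setD1K iS) setUS.
move=> T0 U0 sTU; apply/eqP; rewrite eqEsubset.
by apply/andP; split; [exact: half U0 (esym sTU) | exact: half T0 sTU].
Qed.

Lemma large_neq0 T : large T -> T != set0.
Proof. by rewrite /large -card_gt0 => /ltnW. Qed.

Lemma uniq_relations1 : uniq (relations1 n).
Proof.
(* Sending each [c T] to [vT T] maps [relation1 T] to [s (vT T)]. *)
pose g : Acring n -> Cring n :=
  mmap (\val : Aring n -> Cring n) (fun e => vT (val (enum_val e))).
have g_rel T : (3 <= #|T|)%N -> g (relation1 T) = s (vT T).
  move=> T3; transitivity (\sum_(i in T) g (uA i *: c (T :\ i))).
    exact: raddf_sum.
  rewrite s_vT; apply: eq_bigr => i iT; rewrite /g mmapZ; congr (_ * _).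
  have lT : large (T :\ i) by move: T3; rewrite /large (cardsD1 i) iT.
  rewrite -[T :\ i]/(val (Sub (T :\ i) lT : largeset n)) c_large mmapX mmap1U.
  by rewrite enum_rankK.
rewrite map_inj_in_uniq ?enum_uniq // => T U.
rewrite !mem_enum !inE => T3 U3 /(congr1 g); rewrite (g_rel _ T3) (g_rel _ U3).
by apply: s_vT_inj; rewrite -card_gt0; [exact: leq_trans T3 | exact: leq_trans U3].
Qed.

Lemma uniq_relations2 : uniq (relations2 n).
Proof.
rewrite map_inj_in_uniq ?enum_uniq // => -[i j] [i' j'].
rewrite !mem_enum !inE /= => ij ij'.
(* With all [c T] sent to 0, [relation2 a b] becomes
   [u a ^+ 2 * v b ^+ 2 + u b ^+ 2 * v a ^+ 2]. *)
pose g (x : Acring n) : k := (Aval x.@[fun=> 0]).@[pt i [set j]].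
have g_rel (a b : 'I_n) : (a < b)%N ->
    g (relation2 a b) = ((a == i) && (b == j))%:R + ((b == i) && (a == j))%:R.
  move=> ab; have lab : large [set a; b].
    by rewrite /large cards2; case: eqP ab => // ->; rewrite ltnn.
  rewrite /g /relation2 -[[set a; b]]/(val (Sub [set a; b] lab : largeset n)).
  rewrite c_large expr2 mevalD mevalM mevalXU mevalC mul0r add0r /=.
  rewrite mevalD !mevalM !meval_u !meval_v !inE.
  by rewrite -!natrM !mulnb !andbb.
move=> /(congr1 g); rewrite !g_rel // !eqxx /=.
have -> : (j == i) = false by rewrite -val_eqE gtn_eqF.
rewrite /= addr0; case: andP => [[/eqP -> /eqP ->] //|_].
case: andP => [[/eqP ji /eqP ij_]|_].
  by move: ij'; rewrite ji ij_ ltnNge ltnW.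
by rewrite !addr0 => /eqP; rewrite oner_eq0.
Qed.

Lemma uniq_generators : (0 < n)%N -> uniq (generators n).
Proof.
move=> n0; rewrite /= map_inj_in_uniq ?enum_uniq ?andbT; last first.
  move=> T U; rewrite !mem_enum !inE => lT lU.
  by apply: s_vT_inj; exact: large_neq0.
apply/imageP => -[T]; rewrite inE => lT.
move=> /(congr1 (meval (pt (Ordinal n0) set0))); rewrite rmorph1 meval_s_vT.
case: andP => [[iT]|_ /eqP]; last by rewrite oner_eq0.
rewrite subset0 -cards_eq0; move: lT; rewrite /large (cardsD1 (Ordinal n0)) iT.
by case: #|_|.
Qed.

Lemma size_generators : size (generators n) = (1 + (2 ^ n - n - 1))%N.
Proof. by rewrite /= size_image card_sets_large. Qed.

Lemma kers_generators (p : Cring n) : p \in kers n <->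
  exists a : 'I_(size (generators n)) -> Aring n,
    p = \sum_(i < size (generators n)) Aval (a i) * (generators n)`_i.
Proof.
split=> [/eqP/kers_span[a0 [w ->]]|[a ->]]; last first.
  apply: rpred_sum => e _; apply: rpredM; first exact: inA_kers.
  have := mem_nth 0 (ltn_ord e); rewrite inE => /orP[/eqP ->|/imageP[T _ ->]].
    exact: rpred1.
  exact: s_kers.
set r := enum [set T : {set 'I_n} | large T].
pose A d := if d is d'.+1 then w (nth set0 r d') else a0.
exists (fun e => A e).
rewrite -(big_mkord xpredT (fun d => Aval (A d) * (generators n)`_d)).
rewrite [size _]/= big_nat_recl //= mulr1 size_map; congr (_ + _).
rewrite (eq_bigl (fun T => T \in [set T : {set 'I_n} | large T])); last first.
  by move=> T; rewrite inE.
rewrite -big_enum /= (big_nth set0) !big_nat; apply: eq_bigr => d /andP[_ dr].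
by rewrite (nth_map set0).
Qed.

End Counting.

Theorem theorem2p0p1 (n : nat) (hn : (0 < n)%N) :
  (* (I) *)
  [/\ forall p : Cring n, s (s p) = 0,
      forall p : Cring n, p \in kers n <->
        exists (q : Cring n) (a : Aring n), p = s q + Aval a,
      forall p : Cring n, p \in kers n <->
        exists a : 'I_(size (generators n)) -> Aring n,
          p = \sum_(i < size (generators n)) Aval (a i) * (generators n)`_i
    & uniq (generators n) /\
      size (generators n) = (1 + (2 ^ n - n - 1))%N ] /\
  (* (II) *)
  [/\ #|{: largeset n}| = (2 ^ n - n - 1)%N,
      uniq (relations1 n) /\
      size (relations1 n) = (2 ^ n - (n * (n - 1)) %/ 2 - n - 1)%N,
      uniq (relations2 n) /\
      size (relations2 n) = ((n * (n - 1)) %/ 2)%N,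
      size (relations3 n) = ((2 ^ n - n - 1) ^ 2 - (n * (n - 1)) %/ 2)%N
    & exists f : {lrmorphism Qring n -> Bring n},
        bijective f /\
        forall T : {set 'I_n}, large T ->
          Bval (f (\pi_(Qring n) (c T))) = s (vT T) ].
Proof.
split; split.
- exact: ss0.
- move=> p; split=> [/eqP sp|[q [a ->]]].
    by exists (hom p), (MkA (rest_inA p)); exact: kers_decomp.
  by apply: rpredD; [exact: s_kers | exact: inA_kers].
- exact: kers_generators.
- by split; [exact: uniq_generators | exact: size_generators].
- exact: card_largeset.
- by split; [exact: uniq_relations1 | rewrite size_image card_sets_ge3].
- by split; [exact: uniq_relations2 | rewrite size_image card_ltn_pairs].
- exact: size_relations3.
- exists (@qmap n : {lrmorphism Qring n -> Bring n}); split; first exact: qmap_bij.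
  by move=> T _; rewrite /= qmap_pi ev_c.
Qed.
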